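(* For every integer $n \ge 6$, the map $$C(n) \times C(n) \to A_n, \quad (\tau, \pi) \mapsto [\tau, \pi]$$ is surjective. That is, every even permutation in $S_n$ is of the form $[\tau,\pi]$ for some $n$-cycles $\tau, \pi \in S_n$.
   Context: $S_n$ is the symmetric group on the symbols $\{1,\dots,n\}$ and $A_n \subset S_n$ is the alternating group. $C(n) \subset S_n$ denotes the conjugacy class of all $n$-cycles (cycles of full length $n$). The commutator is $[\tau,\pi] := \tau^{-1}\pi^{-1}\tau\pi$, with products of permutations composed from right to left. *)

(* Defs.v *)
From mathcomp Require Import all_boot all_fingroup all_solvable.

Set Implicit Arguments.
Unset Strict Implicit.
Unset Printing Implicit Defensive.

Local Open Scope group_scope.

(* The permutations s = (c_0 c_1 ... c_(n-1)), where c lists all the symbols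
   without repetition. The symbols are 0, ..., n-1 instead of 1, ..., n. *)
Definition full_cycles (n : nat) : {set 'S_n} :=
  [set s : 'S_n | [exists c : n.-tuple 'I_n, uniq c && fcycle s c]].

(* The product of {perm T} in MathComp composes from left to right, i.e.,
   (s * t) x = t (s x); here rlmul s t x = s (t x). *)
Definition rlmul (T : finType) (s t : {perm T}) : {perm T} := t * s.

(* tau^-1 pi^-1 tau pi, composed from right to left. Because of the order of
   composition this is not the library's [~ tau, pi]; it is [~ pi^-1, tau^-1]. *)
Definition rlcomm (T : finType) (tau pi : {perm T}) : {perm T} :=
  rlmul (rlmul (rlmul tau^-1 pi^-1) tau) pi.

(* Main.v *)
Require Import Defs.
From mathcomp Require Import all_boot all_fingroup all_solvable.

Set Implicit Arguments.
Unset Strict Implicit.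
Unset Printing Implicit Defensive.

(** Since products are composed from right to left, [tau, pi] = sigma means
    tau pi = pi tau sigma. The class of all n-cycles is invariant under
    conjugation, so whether this equation has solutions in n-cycles depends
    only on the cycle type of sigma, and one can try to assemble a solution for
    a type from solutions for smaller types. Two constructions do this.

    Gluing. Suppose that (tau1, pi1) and (tau2, pi2) solve the problem for
    permutations sigma1 and sigma2 of disjoint sets, and that there are points
    x1 and x2 with tau1 x1 = pi1 x1 and tau2 x2 = pi2 x2 (good points). Compose
    both tau1 tau2 and pi1 pi2 on the left with the transposition s = (x1 x2).
    This joins the two cycles of each into a single cycle, and it does not
    change the commutator: this one becomes
      tau^-1 s pi^-1 s s tau s pi = tau^-1 s (pi^-1 tau) s pi,
    and s commutes with pi^-1 tau, which fixes x1 and x2. Again x1 is good. So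
    the types realized with a good point are closed under disjoint union
    (realizable_cat).

    Extension. Fix a point m and add two new points a and b: replace tau by
    tau c and pi by pi c^-1 for the 3-cycle c = (m b a). In the cyclic words of
    tau and pi this inserts b, a, respectively a, b, after m. Put u = pi^-1 m
    and v = pi^-1 tau^-1 pi m. The cyclic word of the commutator is cut only next
    to m, u and v, and reassembled there. If these three points lie on one cycle of sigma in the cyclic order m, v, u,
    that is, if this cycle reads m P Q R with v the last point of P and u the
    last point of Q, then it becomes a Q b P m R: it gets longer by 2, the other
    cycles stay the same, and a has the property that m had, with Q and b P m in
    place of P and Q. So m is called a mark, the step can be repeated
    (marked_realizable_extend), and marks on different cycles do not disturb
    each other.

    An even permutation has an even number of cycles of even length. A short
    list of explicit solutions, extended at their marks, yields the types (1),
    (k) for odd k at least 5, (a, b) for even a and b other than (2, 2), (3, 3)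
    and (2, 2, 2, 2), as well as their unions with a leftover (3) or (2, 2),
    except for (1, 2, 2). Peeling off such blocks shows that an even type is
    realizable unless it is empty, (3), (2, 2) or (2, 2, 1)
    (nearly_realizable_even), and these have fewer than 6 points. *)

(** * The successor function of a cyclic sequence *)

Section Next.

Variable T : eqType.
Implicit Types (s t : seq T) (x y z m a b : T).

Lemma next_inj s : uniq s -> injective (next s).
Proof. by move=> Us; apply: can_inj (prev_next Us). Qed.

Lemma next_mid s1 s2 y z :
  uniq (s1 ++ y :: z :: s2) -> next (s1 ++ y :: z :: s2) y = z.
Proof.
by move=> Us; rewrite -(next_rot (size s1) Us) rot_size_cat /= eqxx.
Qed.

Lemma next_last x s : uniq (x :: s) -> next (x :: s) (last x s) = x.
Proof.
case/lastP: s => [|s z] Us; first by rewrite /= eqxx.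
by rewrite last_rcons -(next_rotr 1 Us) -rcons_cons rotr1_rcons /= eqxx.
Qed.

(** Positions inside a concatenation are addressed through the last point of a
    block, because the marks of a cycle are the last points of its blocks. *)
Lemma next_junction s0 x s y t :
    uniq (s0 ++ (x :: s) ++ y :: t) ->
  next (s0 ++ (x :: s) ++ y :: t) (last x s) = y.
Proof. by rewrite lastI cat_rcons catA => /next_mid. Qed.

Lemma next_block s1 x s s2 y :
    uniq (s1 ++ (x :: s) ++ s2) -> y \in x :: s -> y != last x s ->
  next (s1 ++ (x :: s) ++ s2) y = next (x :: s) y.
Proof.
move=> Us; have : uniq (x :: s).
  by move: Us; rewrite !cat_uniq => /and3P[_ _ /and3P[]].
move: Us; rewrite lastI mem_rcons inE; case: eqP => //= _.
move: (last x s) (belast x s) => z {}s Us Usz ys _.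
case/splitPr: ys Us Usz => p1 [|w p2].
  by rewrite -cats1 -!catA /= catA => Us Usz; rewrite !next_mid.
by rewrite rcons_cat /= -!catA /= catA => Us Usz; rewrite !next_mid.
Qed.

(** The value at a is the former successor of m, also when m was alone: this is
    the action of the 3-cycle (m b a) followed by the old successor function. *)
Lemma next_insert_two m a b s y :
  next (m :: b :: a :: s) y =
  if y == m then b else if y == b then a else
  next (m :: s) (if y == a then m else y).
Proof.
rewrite /=; case: eqP => // ym; case: eqP => // _.
by case: eqP => [->|/eqP/negPf ya]; case: s => //= *; rewrite ?eqxx ?ya //;
   case: eqP ym.
Qed.

(** Concatenating two cyclic words is composing the two cycles, on the left,
    with the transposition of their first letters: the arrow that returned to
    x1 now goes to x2. *)
Lemma next_cat x1 s1 x2 s2 y :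
    uniq (x1 :: s1) -> y \in x1 :: s1 ->
  next ((x1 :: s1) ++ x2 :: s2) y =
  if next (x1 :: s1) y == x1 then x2 else next (x1 :: s1) y.
Proof.
move=> /andP[x1s1 _] ys1; rewrite !next_nth mem_cat ys1 index_cat ys1.
move: ys1; rewrite -index_mem ltnS; move: (index y _) => i le_i /=.
rewrite nth_cat; case: ltnP => [lt_i|ge_i].
  by case: eqP => // eq_x1; case/negP: x1s1; rewrite -{1}eq_x1; apply: mem_nth.
have -> : i = size s1 by apply/eqP; rewrite eqn_leq le_i ge_i.
by rewrite subnn /= nth_default // eqxx.
Qed.

End Next.

(** * Solutions of the commutator equation *)

Section Solutions.

Variable T : eqType.
Implicit Types (s c : seq T) (b : seq (seq T)) (cs : seq (seq T))
  (bs : seq (seq (seq T))) (l : seq nat) (d : seq (seq nat)).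

(** A permutation is given by the list of its cycles, and a cycle c may be cut
    into blocks b with c = flatten b; bs is then a list of lists of blocks. *)
Definition points bs := flatten (map flatten bs).

(** The equation f g = g f sigma at the points of one cycle c of sigma. It says
    that sigma = f^-1 g^-1 f g there. *)
Definition solves_on (f g : T -> T) c :=
  all (fun y => f (g y) == g (f (next c y))) c.

(** The cyclic words st and sp run through all points, so that their successor
    functions are two cycles of full length. The third condition provides a
    good point, without which solutions could not be glued. *)
Definition solution st sp cs :=
  [&& perm_eq st (flatten cs), perm_eq sp (flatten cs),
      has (fun x => next st x == next sp x) st
    & all (solves_on (next st) (next sp)) cs].

(** A cycle cut into three blocks is marked at its first point m. With
    u = last m Q and v = last m P, the two equations say that u = g^-1 m and
    v = g^-1 f^-1 g m, so that m, v, u follow each other in this cyclic order.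
    A cut into any other number of blocks carries no mark. *)
Definition is_mark (f g : T -> T) b :=
  if b is [:: m :: P; Q; R] then
    (g (last m Q) == m) && (f (g (last m P)) == g m)
  else true.

Definition marked_solution st sp bs :=
  solution st sp (map flatten bs) && all (is_mark (next st) (next sp)) bs.

(** Asking for a solution for every permutation of the given type, rather than
    for one of them, spares conjugating solutions. *)
Definition realizable l := forall cs,
  shape cs = l -> uniq (flatten cs) -> exists st sp, solution st sp cs.

Definition marked_realizable d := forall bs,
  map shape bs = d -> uniq (points bs) -> exists st sp, marked_solution st sp bs.

End Solutions.

(** * Lengthening a marked cycle by two points *)

Section Extension.

Variables (T : eqType) (A : {pred T}) (f g f' g' : T -> T) (a b m : T).
Hypotheses (fI : injective f) (gI : injective g).
Hypotheses (fA : {homo f : y / y \in A}) (gA : {homo g : y / y \in A}).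
Hypotheses (f_move : {in A, forall y, f y != y}).
Hypotheses (g_move : {in A, forall y, g y != y}).
Hypotheses (mA : m \in A) (aA : a \notin A) (bA : b \notin A) (ab : a != b).
Hypothesis f'E : forall y,
  f' y = if y == m then b else if y == b then a else f (if y == a then m else y).
Hypothesis g'E : forall y,
  g' y = if y == m then a else if y == a then b else g (if y == b then m else y).

Let neqA y z : y \in A -> z \notin A -> (y == z) = false.
Proof. by move=> yA; apply: contraNF => /eqP <-. Qed.

Let f'_A y : y \in A -> y != m -> f' y = f y.
Proof. by move=> yA /negPf ym; rewrite f'E ym !neqA //. Qed.
Let g'_A y : y \in A -> y != m -> g' y = g y.
Proof. by move=> yA /negPf ym; rewrite g'E ym !neqA //. Qed.
Let f'm : f' m = b. Proof. by rewrite f'E eqxx. Qed.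
Let g'm : g' m = a. Proof. by rewrite g'E eqxx. Qed.
Let f'b : f' b = a. Proof. by rewrite f'E eqxx eq_sym neqA. Qed.
Let g'a : g' a = b. Proof. by rewrite g'E eqxx eq_sym neqA. Qed.
Let f'a : f' a = f m.
Proof. by rewrite f'E eqxx eq_sym neqA // (negPf ab). Qed.
Let g'b : g' b = g m.
Proof. by rewrite g'E eqxx eq_sym neqA // eq_sym (negPf ab). Qed.

Variables (u v : T).
Hypotheses (uA : u \in A) (vA : v \in A).
Hypotheses (vu : v != u) (gu : g u = m) (fgv : f (g v) = g m).

(** Otherwise f m = g m = f (g v), hence g v = m = g u. So the good point of a
    solution is different from m, and it survives the extension at m. *)
Lemma mark_not_good : f m != g m.
Proof.
apply: contra vu => /eqP fg; apply/eqP/gI.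
by rewrite gu; apply: fI; rewrite fgv.
Qed.

(** Away from m, u and v the new functions agree with the old ones along both
    sides of the equation: g y = m only for y = u, and f z = m only for y = v. *)
Lemma extension_ordinary y z : y \in A -> z \in A ->
    y != m -> y != u -> y != v -> z != m ->
  f (g y) = g (f z) -> f' (g' y) = g' (f' z).
Proof.
move=> yA zA ym yu yv zm rel.
rewrite g'_A // (f'_A zA zm) f'_A ?gA ?g'_A ?fA //.
  by apply: contra yv => /eqP fz; apply/eqP/gI/fI; rewrite fgv rel fz.
by apply: contra yu => /eqP gy; apply/eqP/gI; rewrite gu.
Qed.

Lemma extension_good x : x \in A -> f x = g x -> f' x = g' x.
Proof.
move=> xA fgx; rewrite f'_A ?g'_A //; apply: contra mark_not_good => /eqP <-.
  exact/eqP.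
exact/eqP.
Qed.

(** Each boundary between two blocks of the new cycle is a separate case: there
    the new successor differs from the old one. Inside the blocks nothing has
    changed. *)
Lemma extension_cycle p0 q0 (P Q R : seq T) :
    let c := m :: (p0 :: P) ++ (q0 :: Q) ++ R in
    uniq c -> {subset c <= A} -> v = last p0 P -> u = last q0 Q ->
    solves_on f g c ->
  solves_on f' g' (a :: (q0 :: Q) ++ (b :: p0 :: P) ++ m :: R).
Proof.
move=> c Uc cA def_v def_u /allP rel.
have {}rel y : y \in c -> f (g y) = g (f (next c y)) by move/rel/eqP.
have succ_m : next c m = p0 by rewrite /= eqxx.
have succ_v : next c v = q0 by rewrite def_v; apply: (@next_junction _ [:: m]).
have mc : m \in c by apply: mem_head.
have Pc y : y \in p0 :: P -> y \in c by rewrite !(inE, mem_cat) => ->; rewrite !orbT.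
have Qc y : y \in q0 :: Q -> y \in c by rewrite !(inE, mem_cat) => ->; rewrite !orbT.
have Rc y : y \in R -> y \in c by rewrite !(inE, mem_cat) => ->; rewrite !orbT.
have vP : v \in p0 :: P by rewrite def_v mem_last.
have uQ : u \in q0 :: Q by rewrite def_u mem_last.
case: R @c Uc cA rel succ_m succ_v mc Pc Qc Rc
  => [|r0 R] c Uc cA rel succ_m succ_v mc Pc Qc Rc.
  (* R is nonempty: otherwise the successor of u would be m, and the relation
     at u would make f m a fixed point of g. *)
  have succ_u : next c u = m.
    rewrite def_u -[RHS](next_last Uc) /c cats0; congr (next _ _).
    by rewrite /= last_cat.
  have := rel u (Qc u uQ); rewrite succ_u gu => /esym/eqP.
  by rewrite (negPf (g_move _)) ?fA.
have succ_u : next c u = r0.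
  rewrite def_u /c -cat1s catA; apply: next_junction; rewrite -catA; exact: Uc.
pose w := last r0 R.
have wR : w \in r0 :: R by apply: mem_last.
have succ_w : next c w = m.
  by rewrite -[RHS](next_last Uc); congr (next _ _); rewrite /= !last_cat /= last_cat.
have Uc' : uniq (a :: (q0 :: Q) ++ (b :: p0 :: P) ++ m :: r0 :: R).
  have ac : a \notin c by apply: contra aA; apply: cA.
  have bc : b \notin c by apply: contra bA; apply: cA.
  suff /perm_uniq-> : perm_eq (a :: (q0 :: Q) ++ (b :: p0 :: P) ++ m :: r0 :: R)
                              (a :: b :: c).
    by rewrite 2!cons_uniq in_cons negb_or ab ac bc.
  rewrite perm_cons perm_catCA cat_cons perm_cons /c catA -(cat1s m).
  by rewrite perm_catCA -catA.
set c' := a :: _ in Uc' *.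
have Pm y : y \in p0 :: P -> y != m.
  move=> yP; apply: contraTneq Uc => ym; rewrite ym in yP.
  by rewrite cons_uniq mem_cat yP.
have Qm y : y \in q0 :: Q -> y != m.
  move=> yQ; apply: contraTneq Uc => ym; rewrite ym in yQ.
  by rewrite cons_uniq !mem_cat yQ orbT.
have Rm y : y \in r0 :: R -> y != m.
  move=> yR; apply: contraTneq Uc => ym; rewrite ym in yR.
  by rewrite cons_uniq !mem_cat yR !orbT.
have PQ y : y \in p0 :: P -> y \notin q0 :: Q.
  move: Uc; rewrite /c cons_uniq catA cat_uniq cat_uniq => /and3P[_ /and3P[_ /hasPn PQ _] _].
  by apply: contraTN => /PQ.
have R_PQ y : y \in r0 :: R -> (y \notin p0 :: P) && (y \notin q0 :: Q).
  move: Uc; rewrite /c cons_uniq catA cat_uniq => /and4P[_ _ /hasPn RPQ _] /RPQ.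
  by rewrite mem_cat negb_or.
have neq_of y z (s : seq T) : y \in s -> z \notin s -> y != z.
  by move=> ys; apply: contraNneq => <-.
have fm_m : f m != m by apply: f_move.
have gm_m : g m != m by apply: g_move.
have [vQ /andP[wP wQ]] := (PQ v vP, R_PQ w wR).
have ordinary y : y \in c -> y != m -> y != u -> y != v -> next c y != m ->
    next c' y = next c y -> f' (g' y) = g' (f' (next c' y)).
  move=> yc ym yu yv szm ->.
  by apply: extension_ordinary => //; [apply: cA | apply: cA; rewrite mem_next | apply: rel].
apply/allP => y; rewrite (in_cons a) !mem_cat (in_cons b) (in_cons m) => y_cases.
apply/eqP; case/or3P: y_cases => [/eqP-> | yQ | /orP[/orP[/eqP-> | yP] | /orP[/eqP-> | yR]]].
- have -> : next c' a = q0 by rewrite /c' /= eqxx.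
  have fq0 : f q0 = m by apply: gI; rewrite -fgv rel ?Pc // succ_v.
  by rewrite g'a f'b f'_A ?fq0 ?cA ?Qc ?mem_head // Qm ?mem_head.
- have [-> | yu] := eqVneq y u.
    have -> : next c' u = b.
      by rewrite def_u (@next_junction _ [:: a] q0 Q b _ Uc').
    by rewrite f'b g'a g'_A ?gu ?f'm // Qm.
  have yu' : y != last q0 Q by rewrite -def_u.
  have succ_y : next c y = next (q0 :: Q) y.
    exact: (@next_block _ (m :: p0 :: P) q0 Q _ y Uc yQ yu').
  apply: ordinary => //; first exact: Qc.
  + exact: Qm.
  + exact: neq_of yQ vQ.
  + by rewrite succ_y Qm ?mem_next.
  by rewrite succ_y (@next_block _ [:: a] q0 Q _ y Uc' yQ yu').
- have -> : next c' b = p0.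
    have := @next_junction _ (a :: q0 :: Q) b [::] p0 (P ++ m :: r0 :: R) Uc'.
    by [].
  have p0P : p0 \in p0 :: P by apply: mem_head.
  have relm : f (g m) = g (f p0) by rewrite rel // succ_m.
  rewrite g'b (f'_A (gA mA)) // (f'_A (cA _ (Pc _ p0P))) ?Pm // g'_A ?fA ?cA ?Pc //.
  apply: contra (f_move (gA mA)) => /eqP fp0; by rewrite relm fp0.
- have [->|yv] := eqVneq y v.
    have -> : next c' v = m.
      rewrite def_v.
      exact: (@next_junction _ (a :: q0 :: Q) b (p0 :: P) m (r0 :: R) Uc').
    rewrite f'm g'b g'_A ?Pm // f'_A ?gA //.
    by apply: contra vu => /eqP gv; apply/eqP/gI; rewrite gu.
  have yv' : y != last p0 P by rewrite -def_v.
  have succ_y : next c y = next (p0 :: P) y.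
    exact: (@next_block _ [:: m] p0 P _ y Uc yP yv').
  have yu : y != u by rewrite eq_sym (neq_of _ _ _ uQ (PQ y yP)).
  apply: ordinary => //; first exact: Pc.
  + exact: Pm.
  + by rewrite succ_y Pm ?mem_next.
  rewrite succ_y /c' -/(((b :: p0 :: P) ++ m :: r0 :: R)).
  have Ub := Uc'; rewrite /c' -[b :: p0 :: P]cat1s -catA catA -cat_cons in Ub *.
  by rewrite (@next_block _ ((a :: q0 :: Q) ++ [:: b]) p0 P _ y Ub yP yv').
- have -> : next c' m = r0.
    have := @next_junction _ ((a :: q0 :: Q) ++ b :: p0 :: P) m [::] r0 R.
    by rewrite -catA; apply; exact: Uc'.
  have r0R : r0 \in r0 :: R by apply: mem_head.
  have relu : f m = g (f r0) by rewrite -succ_u -rel ?Qc // gu.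
  rewrite g'm f'a (f'_A (cA _ (Rc _ r0R))) ?Rm // g'_A ?fA ?cA ?Rc //.
  by apply: contra mark_not_good => /eqP fr0; rewrite relu fr0.
- have wu : w != u by rewrite eq_sym (neq_of _ _ _ uQ wQ).
  have [->|yw] := eqVneq y w.
    have -> : next c' w = a.
      by rewrite -[RHS](next_last Uc'); congr (next _ _); rewrite /= !last_cat /= last_cat.
    have wA := cA _ (Rc _ wR).
    have gw_m : g w != m.
      by apply: contra wu => /eqP gw; apply/eqP/gI; rewrite gu.
    rewrite f'a (g'_A (fA mA) fm_m) (g'_A wA (Rm _ wR)) (f'_A (gA wA) gw_m).
    by rewrite (rel _ (Rc _ wR)) succ_w.
  have /andP[yP yQ] := R_PQ y yR.
  have succ_y : next c y = next (r0 :: R) y.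
    have := @next_block _ ((m :: p0 :: P) ++ q0 :: Q) r0 R [::] y.
    by rewrite -catA cats0; apply.
  apply: ordinary => //; first exact: Rc.
  + exact: Rm.
  + by rewrite eq_sym (neq_of _ _ _ uQ yQ).
  + by rewrite eq_sym (neq_of _ _ _ vP yP).
  + by rewrite succ_y Rm ?mem_next.
  rewrite succ_y.
  have := @next_block _ ((a :: q0 :: Q) ++ (b :: p0 :: P) ++ [:: m]) r0 R [::] y.
  by rewrite -!catA cats0; apply.
Qed.

(** A mark involves only f and g at points of its own cycle and the images of
    these, so a mark on a cycle that avoids m and u persists. *)
Lemma extension_other_mark m2 u2 v2 :
    m2 \in A -> u2 \in A -> v2 \in A -> m2 != m -> u2 != m -> v2 != m ->
    v2 != u -> g u2 = m2 -> f (g v2) = g m2 ->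
  g' u2 = m2 /\ f' (g' v2) = g' m2.
Proof.
move=> m2A u2A v2A m2m u2m v2m v2u gu2 fgv2.
rewrite (g'_A u2A u2m) (g'_A v2A v2m) (g'_A m2A m2m) f'_A ?gA //.
by apply: contra v2u => /eqP gv2; apply/eqP/gI; rewrite gu.
Qed.

End Extension.

Section ExtendMarked.

Variable T : eqType.

Lemma next_neq (s : seq T) y : uniq s -> 1 < size s -> y \in s -> next s y != y.
Proof.
move=> Us s1 ys; have [i t def_t] := rot_to ys.
rewrite -(next_rot i Us) def_t; move: Us s1; rewrite -(rot_uniq i) -(size_rot i) def_t.
by case: t {def_t} => //= z t; rewrite inE negb_or eqxx eq_sym => /andP[/andP[]].
Qed.

(** The lengths of the blocks m P, Q, R become those of a Q, b P m, R; the first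
    two trade places and both grow by one. The hypotheses make P and Q
    nonempty. *)
Lemma marked_realizable_extend s1 s2 s3 d :
    1 < s1 -> 0 < s2 -> marked_realizable T ([:: s1; s2; s3] :: d) ->
  marked_realizable T ([:: s2.+1; s1.+1; s3] :: d).
Proof.
move=> s1_gt1 s2_gt0 IH [|[|[|a [|q0 Q]] [|B2 [|R [|? ?]]]] bs] // [].
  by move=> ?; subst s2.
case: B2 => [|b B2] //; case/lastP: B2 => [|[|p0 P] m] //.
  by rewrite /= => _ [?]; subst s1.
  by rewrite /= => _ [?]; subst s1.
rewrite /= size_rcons => sQ [sP] sR sbs Unew.
pose b0 := [:: m :: p0 :: P; q0 :: Q; R].
pose bs' := b0 :: bs.
have def_bs : points bs' = m :: (p0 :: P) ++ (q0 :: Q) ++ R ++ points bs.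
  by rewrite /points /bs' /b0 /= cats0 -!catA /= -!catA.
have perm_new s : perm_eq s (points bs') -> perm_eq (a :: b :: s)
   (points ([:: a :: q0 :: Q; b :: rcons (p0 :: P) m; R] :: bs)).
  move=> s_old; apply: (@perm_trans _ (a :: b :: points bs')).
    by rewrite !perm_cons.
  rewrite def_bs /points /= cats0 -cats1 perm_cons -!catA -!cat_cons -!catA.
  rewrite perm_sym perm_catCA cat_cons perm_cons catA perm_catCA.
  by rewrite perm_cons -catA.
have : uniq (a :: b :: points bs').
  by rewrite (perm_uniq (perm_new _ (perm_refl _))).
rewrite 2!cons_uniq in_cons negb_or => /and3P[/andP[ab aA] bA Uold].
have [||st [sp /andP[/and4P[st_pts sp_pts good sol] marks]]] := IH bs'.
- by rewrite /= -sQ -sP -sR sbs.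
- exact: Uold.
have mA : m \in points bs' by rewrite def_bs mem_head.
have Ust : uniq st by rewrite (perm_uniq st_pts).
have Usp : uniq sp by rewrite (perm_uniq sp_pts).
have mst : m \in st by rewrite (perm_mem st_pts).
have msp : m \in sp by rewrite (perm_mem sp_pts).
have [i s def_s] := rot_to mst; have [j t def_t] := rot_to msp.
pose f := next st; pose g := next sp.
pose f' := next (m :: b :: a :: s); pose g' := next (m :: a :: b :: t).
have f'E y : f' y = if y == m then b else if y == b then a else
                    f (if y == a then m else y).
  by rewrite /f' next_insert_two -def_s /f next_rot.
have g'E y : g' y = if y == m then a else if y == a then b else
                    g (if y == b then m else y).
  by rewrite /g' next_insert_two -def_t /g next_rot.
have fI : injective f := next_inj Ust.
have gI : injective g := next_inj Usp.
have fA : {homo f : y / y \in points bs'}.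
  by move=> y; rewrite -!(perm_mem st_pts) mem_next.
have gA : {homo g : y / y \in points bs'}.
  by move=> y; rewrite -!(perm_mem sp_pts) mem_next.
have size_pts : 1 < size (points bs') by rewrite def_bs.
have f_move : {in points bs', forall y, f y != y}.
  by move=> y yA; apply: next_neq; rewrite ?(perm_size st_pts) ?(perm_mem st_pts).
have g_move : {in points bs', forall y, g y != y}.
  by move=> y yA; apply: next_neq; rewrite ?(perm_size sp_pts) ?(perm_mem sp_pts).
move: sol marks => /= /andP[sol0 sol] /andP[/andP[/eqP gu /eqP fgv] marks].
pose u := last q0 Q; pose v := last p0 P.
have uQ : u \in q0 :: Q := mem_last _ _.
have vP : v \in p0 :: P := mem_last _ _.
have uA : u \in points bs' by rewrite def_bs inE !mem_cat uQ !orbT.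
have vA : v \in points bs' by rewrite def_bs inE !mem_cat vP !orbT.
have vu : v != u.
  move: Uold; rewrite def_bs cons_uniq catA cat_uniq cat_uniq.
  case/and3P=> _ /and3P[_ /hasPn PQ _] _.
  by apply: contraNneq (PQ u uQ) => <-.
exists (m :: b :: a :: s), (m :: a :: b :: t).
have b_new b1 : b1 \in bs -> {subset flatten b1 <= points bs'} /\
    {in flatten b1, forall y, [/\ y != m, y != u & y != v]}.
  move=> b1bs; have sub1 : {subset flatten b1 <= points bs}.
    by move=> y yb1; apply/flattenP; exists (flatten b1) => //; apply: map_f.
  split=> [y /sub1|y /sub1 y_bs].
    by rewrite def_bs inE !mem_cat => ->; rewrite !orbT.
  move: Uold; rewrite def_bs 2!catA -cat_cons cat_uniq.
  case/and3P=> _ /hasPn/(_ y y_bs) y_new _.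
  by split; apply: contraNneq y_new => ->;
     rewrite inE !mem_cat ?vP ?uQ ?eqxx ?orbT.
apply/andP; split; first (apply/and4P; split).
- apply: (perm_trans _ (perm_new (m :: s) _)); last first.
    by rewrite -def_s perm_rot.
  rewrite -cat1s (perm_catCA [:: m] [:: b; a] s) /=.
  exact: (permEl (perm_catCA [:: b] [:: a] _)).
- apply: (perm_trans _ (perm_new (m :: t) _)); last first.
    by rewrite -def_t perm_rot.
  exact: (permEl (perm_catCA [:: m] [:: a; b] t)).
- have /hasP[x xst /eqP fgx] := good.
  have xA : x \in points bs' by rewrite -(perm_mem st_pts).
  apply/hasP; exists x; last first.
    apply/eqP; exact: (extension_good fI gI aA bA f'E g'E vu gu fgv xA fgx).
  by move: xst; rewrite -(mem_rot i) def_s !inE => /orP[->|->]; rewrite ?orbT.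
- apply/andP; split.
    have {}sol0 : solves_on f g (m :: (p0 :: P) ++ (q0 :: Q) ++ R).
      by move: sol0; rewrite /= cats0.
    have := extension_cycle fI gI fA gA f_move g_move mA aA bA ab f'E g'E
              uA vA vu gu fgv _ _ (erefl v) (erefl u) sol0.
    have -> : flatten [:: a :: q0 :: Q; b :: rcons (p0 :: P) m; R]
              = a :: (q0 :: Q) ++ (b :: p0 :: P) ++ m :: R.
      by rewrite /= cats0 cat_rcons.
    apply; last by move=> y yc; rewrite def_bs 2!catA -cat_cons mem_cat -catA yc.
    by move: Uold; rewrite def_bs 2!catA -cat_cons cat_uniq -catA => /and3P[].
  apply/allP => _ /mapP[b1 b1bs ->].
  have [b1A b1_new] := b_new _ b1bs.
  have /allP sol1 := allP sol _ (map_f flatten b1bs).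
  apply/allP => y yb1; have [ym yu yv] := b1_new y yb1.
  have zb1 : next (flatten b1) y \in flatten b1 by rewrite mem_next.
  have [zm _ _] := b1_new _ zb1.
  apply/eqP; apply: (extension_ordinary fI gI fA gA aA bA f'E g'E gu fgv) => //.
  + exact: b1A.
  + exact: b1A.
  + exact/eqP/sol1.
- apply/andP; split.
    have um : (u == m) = false.
      by apply/negbTE; apply: contraNneq (g_move _ uA) => um; rewrite [g u]gu um.
    have uB x : x \notin points bs' -> (u == x) = false.
      by move=> xA; apply: contraNF xA => /eqP <-.
    have aB : (a == m) = false by rewrite eq_sym; apply: contraNF aA => /eqP <-.
    change (is_true ((g' (last b (rcons (p0 :: P) m)) == a)
                     && (f' (g' u) == g' a))).
    rewrite last_rcons (g'E u) um !uB // [g u]gu (g'E m) (f'E m) (g'E a) aB.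
    by rewrite !eqxx.
  apply/allP => b1 b1bs; have := allP marks _ b1bs.
  have [b1A b1_new] := b_new _ b1bs.
  case: b1 b1bs b1A b1_new => [|[|m2 P2] [|Q2 [|R2 []]]] // b1bs b1A b1_new.
  move=> /andP[/eqP gu2 /eqP fgv2].
  have m2b : m2 \in flatten [:: m2 :: P2; Q2; R2] by rewrite mem_head.
  have v2b : last m2 P2 \in flatten [:: m2 :: P2; Q2; R2].
    by rewrite mem_cat mem_last.
  have u2b : last m2 Q2 \in flatten [:: m2 :: P2; Q2; R2].
    by have := mem_last m2 Q2; rewrite /= !(inE, mem_cat) => /orP[]->; rewrite ?orbT.
  have [[m2m _ _] [u2m _ _] [v2m v2u _]] := And3 (b1_new _ m2b) (b1_new _ u2b) (b1_new _ v2b).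
  have [] := extension_other_mark gI gA aA bA f'E g'E gu
    (b1A _ m2b) (b1A _ u2b) (b1A _ v2b) m2m u2m v2m v2u gu2 fgv2.
  by move=> g'u2 f'gv2; apply/andP; split; apply/eqP.
Qed.

End ExtendMarked.

(** * Transport and gluing of solutions *)

Section Realizability.

Variable T : eqType.

Lemma lift_perm_map (T1 T2 : eqType) (h : T1 -> T2) (s : seq T1) (t : seq T2) :
  perm_eq (map h s) t -> exists2 s', perm_eq s s' & map h s' = t.
Proof.
elim: t s => [|k t IH] s.
  by move=> /perm_size /=; rewrite size_map => /size0nil->; exists [::].
move=> perm_s; have: k \in map h s by rewrite (perm_mem perm_s) mem_head.
case/mapP=> c c_s k_c; have perm_rem := perm_to_rem c_s.
have /IH[s' perm_s' <-] : perm_eq (map h (rem c s)) t.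
  by rewrite -(perm_cons k) -(permPr perm_s) perm_sym k_c (perm_map h perm_rem).
by exists (c :: s'); rewrite /= ?k_c // (permPl perm_rem) perm_cons.
Qed.

Lemma realizable_perm l l' : perm_eq l l' -> realizable T l -> realizable T l'.
Proof.
move=> perm_l IH cs def_l' Ucs; move: perm_l; rewrite perm_sym -def_l'.
case/lift_perm_map=> cs' perm_cs shape_cs'.
have perm_pts := perm_flatten perm_cs.
have [|st [sp]] := IH _ shape_cs'; first by rewrite -(perm_uniq perm_pts).
rewrite /solution -!(permPr perm_pts) -(perm_all _ perm_cs) => sol.
by exists st, sp.
Qed.

Lemma marked_realizable_perm d d' :
  perm_eq d d' -> marked_realizable T d -> marked_realizable T d'.
Proof.
move=> perm_d IH bs def_d' Ubs; move: perm_d; rewrite perm_sym -def_d'.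
case/lift_perm_map=> bs' perm_bs shape_bs'.
have perm_pts := perm_flatten (perm_map flatten perm_bs).
have [|st [sp]] := IH _ shape_bs'; first by rewrite -(perm_uniq perm_pts).
rewrite /marked_solution /solution -!(permPr perm_pts) -(perm_all _ perm_bs).
by rewrite -(perm_all _ (perm_map _ perm_bs)) => sol; exists st, sp.
Qed.

(** A list of cycle lengths is realizable if its cycles can be cut so that the
    marked problem becomes solvable. *)
Lemma realizable_forget d :
  marked_realizable T d -> realizable T (map sumn d).
Proof.
move=> IH cs cs_d Ucs.
have [bs bs_d def_cs] : exists2 bs, map shape bs = d & map flatten bs = cs.
  elim: d cs cs_d {IH Ucs} => [|s d IH] [|c cs] //; first by exists [::].
  case=> c_s /IH[bs bs_d bs_cs]; exists (reshape s c :: bs) => /=.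
    by rewrite reshapeKl ?bs_d ?c_s.
  by rewrite reshapeKr ?bs_cs ?c_s.
have [|st [sp /andP[sol _]]] := IH bs bs_d; first by rewrite /points def_cs.
by exists st, sp; rewrite -def_cs.
Qed.

Lemma next_map_in (T0 : eqType) (h : T0 -> T) s y :
    {in s &, injective h} -> uniq s -> y \in s ->
  next (map h s) (h y) = h (next s y).
Proof.
move=> hI Us ys; have Uhs : uniq (map h s) by rewrite map_inj_in_uniq.
case/splitPr: ys hI Us Uhs => s1 [|z s2] hI Us; last first.
  by rewrite map_cat /= => Uhs; rewrite !next_mid.
rewrite cats1 map_rcons; case: s1 {hI} Us => [|x s1]; first by rewrite /= !eqxx.
rewrite cats1 => Us Uhs.
have := next_last Us; rewrite last_rcons => ->.
by have := next_last Uhs; rewrite last_rcons.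
Qed.

Lemma eq_from_points_shape (bs bs' : seq (seq (seq T))) :
  points bs = points bs' -> map shape bs = map shape bs' -> bs = bs'.
Proof.
move=> eq_pts eq_shape; have eq_flat : map flatten bs = map flatten bs'.
  apply: eq_from_flatten_shape => //; rewrite /shape -!map_comp.
  rewrite !(eq_map (size_flatten (T := T))) !(map_comp sumn shape) in eq_shape *.
  by rewrite eq_shape.
elim: bs bs' eq_shape eq_flat {eq_pts} => [|b bs IH] [|b' bs'] //.
by case=> eq_b /IH eq_bs [/eq_from_flatten_shape/(_ eq_b)-> /eq_bs->].
Qed.

Lemma uniq_of_flatten (T0 : eqType) (ss : seq (seq T0)) c :
  uniq (flatten ss) -> c \in ss -> uniq c.
Proof.
move=> Uss c_ss; case/splitPr: c_ss Uss => s1 s2.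
by rewrite flatten_cat !cat_uniq => /and3P[_ _ /andP[]].
Qed.

(** One solution for one choice of points is enough: the bijection that matches
    the points of two lists of blocks of the same shape carries it over. *)
Lemma marked_realizable_witness (T0 : eqType) (st sp : seq T0) bs :
    uniq (points bs) -> marked_solution st sp bs ->
  marked_realizable T (map shape bs).
Proof.
move=> Ubs /andP[/and4P[st_pts sp_pts good sol] marks] bs' shape_bs Ubs'.
have eq_size : size (points bs') = size (points bs).
  by rewrite !size_flatten /shape -!map_comp !(eq_map (size_flatten (T := _)))
             !(map_comp sumn shape) shape_bs.
have [z zst _] := hasP good.
(* The good point shows that there are points at all, hence a default for nth. *)
have [x0 _] : exists x : T, x \in points bs'.
  move: zst; rewrite (perm_mem st_pts) -index_mem -eq_size.
  by case: (points bs') => // x s _; exists x; apply: mem_head.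
pose h y := nth x0 (points bs') (index y (points bs)).
have hI : {in points bs &, injective h}.
  move=> y1 y2 y1s y2s /eqP; rewrite nth_uniq ?eq_size ?index_mem // => /eqP.
  by move/(congr1 (nth y1 (points bs))); rewrite !nth_index.
have def_bs' : bs' = map (map (map h)) bs.
  apply: eq_from_points_shape.
    transitivity (map h (points bs)); last first.
      rewrite /points map_flatten -!map_comp; congr flatten.
      by apply: eq_map => b /=; rewrite map_flatten.
    apply: (@eq_from_nth _ x0) => [|i]; first by rewrite size_map.
    rewrite eq_size => i_lt; have [y0 _] : exists y0, y0 \in points bs.
      by exists z; rewrite -(perm_mem st_pts).
    by rewrite (nth_map y0) // /h index_uniq.
  rewrite shape_bs -map_comp; apply: eq_map => b /=.
  by rewrite /shape -map_comp; apply: eq_map => c /=; rewrite size_map.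
have Ust : uniq st by rewrite (perm_uniq st_pts).
have Usp : uniq sp by rewrite (perm_uniq sp_pts).
pose f := next st; pose g := next sp.
have fE y : y \in points bs -> next (map h st) (h y) = h (f y).
  rewrite -(perm_mem st_pts) => yst; apply: next_map_in => //.
  by move=> y1 y2; rewrite !(perm_mem st_pts); apply: hI.
have gE y : y \in points bs -> next (map h sp) (h y) = h (g y).
  rewrite -(perm_mem sp_pts) => yst; apply: next_map_in => //.
  by move=> y1 y2; rewrite !(perm_mem sp_pts); apply: hI.
have fA y : y \in points bs -> f y \in points bs.
  by rewrite -!(perm_mem st_pts) mem_next.
have gA y : y \in points bs -> g y \in points bs.
  by rewrite -!(perm_mem sp_pts) mem_next.
have flat_bs' : map flatten bs' = map (map h) (map flatten bs).
  by rewrite def_bs' -!map_comp; apply: eq_map => b /=; rewrite map_flatten.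
exists (map h st), (map h sp); apply/andP; split; first (apply/and4P; split).
- by rewrite flat_bs' -map_flatten perm_map.
- by rewrite flat_bs' -map_flatten perm_map.
- have /hasP[y yst /eqP fgy] := good; apply/hasP; exists (h y).
    exact: map_f.
  by move: yst; rewrite (perm_mem st_pts) => y_bs; rewrite fE ?gE // /f fgy.
- rewrite flat_bs'; apply/allP => _ /mapP[c c_bs ->].
  have c_pts y : y \in c -> y \in points bs by move=> yc; apply/flattenP; exists c.
  have Uc : uniq c := uniq_of_flatten Ubs c_bs.
  apply/allP => _ /mapP[y yc ->]; have /allP/(_ y yc)/eqP eq_y := allP sol _ c_bs.
  have y_bs := c_pts y yc; have z_bs : next c y \in points bs.
    by rewrite c_pts ?mem_next.
  rewrite (next_map_in (s := c)) //; last by move=> y1 y2 /c_pts y1s /c_pts y2s; apply: hI.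
  by rewrite gE // fE ?gA // fE // gE ?fA // /f /g eq_y.
rewrite def_bs'; apply/allP => _ /mapP[b b_bs ->].
have b_pts y : y \in flatten b -> y \in points bs.
  by move=> yb; apply/flattenP; exists (flatten b) => //; apply: map_f.
have := allP marks _ b_bs; case: b b_pts {b_bs} => [|[|m P] [|Q [|R []]]] //= b_pts.
case/andP=> /eqP gm /eqP fgm.
have m_bs : m \in points bs by rewrite b_pts ?mem_head.
have u_bs : last m Q \in points bs.
  by rewrite b_pts //; have := mem_last m Q; rewrite !inE !mem_cat => /orP[]->;
     rewrite ?orbT.
have v_bs : last m P \in points bs.
  by rewrite b_pts // -cat_cons mem_cat mem_last.
by rewrite !last_map !gE // fE ?gA // /f /g gm fgm !eqxx.
Qed.

(** One side of the gluing. On A the new functions F and G are f and g followed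
    by the replacement of x by x', where x is good for f and g. Then g y = x if
    and only if f z = x, with z the successor of y, so both sides of the
    equation are redirected at the same points, and there they pass through x',
    at which F and G agree. *)
Lemma solves_on_redirect (f g F G : T -> T) (A : {pred T}) x x' c :
    injective f -> injective g ->
    {homo f : y / y \in A} -> {homo g : y / y \in A} -> {subset c <= A} ->
    {in A, forall y, F y = if f y == x then x' else f y} ->
    {in A, forall y, G y = if g y == x then x' else g y} ->
    F x' = G x' -> x \in A -> f x = g x ->
  solves_on f g c -> solves_on F G c.
Proof.
move=> fI gI fA gA cA FE GE FGx' xA fgx /allP sol; apply/allP => y yc.
have [yA zA] : y \in A /\ next c y \in A by rewrite !cA ?mem_next.
move/(_ y yc)/eqP: sol; move: (next c y) zA => z zA eq_yz.
have gy_fz : (g y == x) = (f z == x).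
  apply/eqP/eqP => [gy | fz].
    by apply: gI; rewrite -eq_yz gy.
  by apply: fI; rewrite eq_yz fz.
rewrite (GE y yA) (FE z zA) -gy_fz; case: ifP => [_|gy]; first exact/eqP.
by rewrite FE ?GE ?fA ?gA // eq_yz.
Qed.

(** Rotate all four words so that they begin with the good points x1 and x2, and
    concatenate. *)
Lemma realizable_cat l1 l2 :
  realizable T l1 -> realizable T l2 -> realizable T (l1 ++ l2).
Proof.
move=> IH1 IH2 cs; pose cs1 := take (size l1) cs; pose cs2 := drop (size l1) cs.
rewrite -(cat_take_drop (size l1) cs) -/cs1 -/cs2 /shape map_cat => shape_cs.
have size_cs1 : size (map size cs1) = size l1.
  rewrite size_map size_takel // -(size_map size cs) -[cs](cat_take_drop (size l1)).
  by rewrite map_cat shape_cs size_cat leq_addr.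
move/eqP: shape_cs; rewrite eqseq_cat // => /andP[/eqP shape1 /eqP shape2].
rewrite flatten_cat cat_uniq => /and3P[U1 /hasPn disj U2].
have [st1 [sp1 /and4P[st1_pts sp1_pts good1 sol1]]] := IH1 _ shape1 U1.
have [st2 [sp2 /and4P[st2_pts sp2_pts good2 sol2]]] := IH2 _ shape2 U2.
have [x1 x1st /eqP fgx1] := hasP good1; have [x2 x2st /eqP fgx2] := hasP good2.
have x1_pts : x1 \in flatten cs1 by rewrite -(perm_mem st1_pts).
have x2_pts : x2 \in flatten cs2 by rewrite -(perm_mem st2_pts).
have x1sp : x1 \in sp1 by rewrite (perm_mem sp1_pts).
have x2sp : x2 \in sp2 by rewrite (perm_mem sp2_pts).
have Ust1 : uniq st1 by rewrite (perm_uniq st1_pts).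
have Usp1 : uniq sp1 by rewrite (perm_uniq sp1_pts).
have Ust2 : uniq st2 by rewrite (perm_uniq st2_pts).
have Usp2 : uniq sp2 by rewrite (perm_uniq sp2_pts).
have [i1 s1 def_s1] := rot_to x1st; have [i2 s2 def_s2] := rot_to x2st.
have [j1 t1 def_t1] := rot_to x1sp; have [j2 t2 def_t2] := rot_to x2sp.
pose st := (x1 :: s1) ++ x2 :: s2; pose sp := (x1 :: t1) ++ x2 :: t2.
have st_pts : perm_eq st (flatten cs1 ++ flatten cs2).
  by rewrite /st -def_s1 -def_s2 perm_cat // perm_rot.
have sp_pts : perm_eq sp (flatten cs1 ++ flatten cs2).
  by rewrite /sp -def_t1 -def_t2 perm_cat // perm_rot.
have Upts : uniq (flatten cs1 ++ flatten cs2).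
  by rewrite cat_uniq U1 U2 andbT; apply/hasPn.
have Ust : uniq st by rewrite (perm_uniq st_pts).
have Usp : uniq sp by rewrite (perm_uniq sp_pts).
have nextE1 s x k u v w (A : seq T) :
    seq.rot k s = x :: u -> uniq s -> perm_eq s A ->
  {in A, forall z, next ((x :: u) ++ v :: w) z
                   = if next s z == x then v else next s z}.
  move=> def_u Us s_A z zA; rewrite -(next_rot k Us) def_u next_cat //.
    by rewrite -def_u rot_uniq.
  by rewrite -def_u mem_rot (perm_mem s_A).
have nextE2 s x k u v w (A : seq T) :
    seq.rot k s = x :: u -> uniq s -> perm_eq s A -> uniq ((v :: w) ++ x :: u) ->
  {in A, forall z, next ((v :: w) ++ x :: u) z
                   = if next s z == x then v else next s z}.
  move=> def_u Us s_A Uall z zA.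
  by rewrite -(next_rot (size (v :: w)) Uall) rot_size_cat (nextE1 s x k u v w A).
(* The second halves of the words st and sp are first halves after a rotation,
   which exchanges the roles of x1 and x2. *)
have F1 := nextE1 _ _ _ _ x2 s2 _ def_s1 Ust1 st1_pts.
have G1 := nextE1 _ _ _ _ x2 t2 _ def_t1 Usp1 sp1_pts.
have F2 := nextE2 _ _ _ _ x1 s1 _ def_s2 Ust2 st2_pts Ust.
have G2 := nextE2 _ _ _ _ x1 t1 _ def_t2 Usp2 sp2_pts Usp.
have F1_x2 : next st x2 = next sp x2 by rewrite F2 // G2 // fgx2.
have F2_x1 : next st x1 = next sp x1 by rewrite F1 // G1 // fgx1.
exists st, sp; apply/and4P; split; first by rewrite flatten_cat.
- by rewrite flatten_cat.
- by apply/hasP; exists x1; rewrite ?F2_x1 // mem_head.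
have closed s (A : seq T) : perm_eq s A -> {homo next s : y / y \in A}.
  by move=> s_A y; rewrite -!(perm_mem s_A) mem_next.
have sub (ss : seq (seq T)) c : c \in ss -> {subset c <= flatten ss}.
  by move=> c_ss y yc; apply/flattenP; exists c.
rewrite all_cat; apply/andP; split; apply/allP => c c_cs.
  apply: (@solves_on_redirect (next st1) (next sp1) (next st) (next sp)
            (mem (flatten cs1)) x1 x2) => //;
    by [apply: next_inj | apply: closed | apply: sub | apply: (allP sol1)].
apply: (@solves_on_redirect (next st2) (next sp2) (next st) (next sp)
          (mem (flatten cs2)) x2 x1) => //;
  by [apply: next_inj | apply: closed | apply: sub | apply: (allP sol2)].
Qed.

End Realizability.

(** * Cycle types that are realized explicitly *)

Section Types.

Variable T : eqType.

Lemma marked_realizable_grow s1 s2 s3 d k :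
    1 < s1 -> 0 < s2 -> marked_realizable T ([:: s1; s2; s3] :: d) ->
  exists t1 t2, [/\ 1 < t1, 0 < t2, t1 + t2 = s1 + s2 + k.*2
                   & marked_realizable T ([:: t1; t2; s3] :: d)].
Proof.
move=> s1_gt1 s2_gt0 R0; elim: k => [|k [t1 [t2 [t1_gt1 t2_gt0 def_t Rt]]]].
  by exists s1, s2; rewrite addn0.
exists t2.+1, t1.+1; split=> //; first by rewrite doubleS !addnS addSn addnC def_t.
exact: marked_realizable_extend.
Qed.

(** Every extension exchanges the lengths of the first two blocks, so only their
    sum is controlled, and this is all that remains when the marks are
    forgotten. *)
Lemma realizable_grow s1 s2 s3 d k :
    1 < s1 -> 0 < s2 -> marked_realizable T ([:: s1; s2; s3] :: d) ->
  realizable T (s1 + s2 + s3 + k.*2 :: map sumn d).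
Proof.
move=> s1_gt1 s2_gt0 /(marked_realizable_grow k s1_gt1 s2_gt0).
case=> t1 [t2 [_ _ def_t /realizable_forget]] /=.
by rewrite addn0 addnA def_t addnAC.
Qed.

(** In the explicit solutions below, pi is the cycle (0 1 2 ...); tau and the
    blocks of the commutator were found by a search. Computation checks
    distinctness of the points, the equation, the good point and the marks. *)
Lemma realizable_1 : realizable T [:: 1].
Proof.
exact: realizable_forget (@marked_realizable_witness T _
  [:: 0] (iota 0 1)
  [:: [:: [:: 0]]]
  isT isT).
Qed.

Lemma realizable_1_3 : realizable T [:: 1; 3].
Proof.
exact: realizable_forget (@marked_realizable_witness T _
  [:: 0; 2; 3; 1] (iota 0 4)
  [:: [:: [:: 3]]; [:: [:: 0; 2; 1]]]
  isT isT).
Qed.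

Lemma realizable_1_1_2_2 : realizable T [:: 1; 1; 2; 2].
Proof.
exact: realizable_forget (@marked_realizable_witness T _
  [:: 0; 1; 5; 3; 4; 2] (iota 0 6)
  [:: [:: [:: 1]]; [:: [:: 4]]; [:: [:: 0; 3]]; [:: [:: 2; 5]]]
  isT isT).
Qed.

Lemma realizable_2_2_2_2 : realizable T [:: 2; 2; 2; 2].
Proof.
exact: realizable_forget (@marked_realizable_witness T _
  [:: 0; 6; 7; 2; 1; 4; 5; 3] (iota 0 8)
  [:: [:: [:: 0; 5]]; [:: [:: 1; 3]]; [:: [:: 2; 6]]; [:: [:: 4; 7]]]
  isT isT).
Qed.

Lemma realizable_2_2_2_2_2_2 : realizable T [:: 2; 2; 2; 2; 2; 2].
Proof.
exact: realizable_forget (@marked_realizable_witness T _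
  [:: 0; 4; 8; 9; 7; 5; 6; 10; 2; 3; 1; 11] (iota 0 12)
  [:: [:: [:: 0; 6]]; [:: [:: 1; 10]]; [:: [:: 2; 11]]; [:: [:: 3; 9]];
      [:: [:: 4; 7]]; [:: [:: 5; 8]]]
  isT isT).
Qed.

Lemma realizable_3_2_2 : realizable T [:: 3; 2; 2].
Proof.
exact: realizable_forget (@marked_realizable_witness T _
  [:: 0; 6; 2; 3; 1; 5; 4] (iota 0 7)
  [:: [:: [:: 0; 5; 3]]; [:: [:: 1; 6]]; [:: [:: 2; 4]]]
  isT isT).
Qed.

Lemma realizable_2_2_2_2_3 : realizable T [:: 2; 2; 2; 2; 3].
Proof.
exact: realizable_forget (@marked_realizable_witness T _
  [:: 0; 7; 6; 2; 1; 5; 10; 8; 9; 4; 3] (iota 0 11)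
  [:: [:: [:: 0; 9]]; [:: [:: 2; 5]]; [:: [:: 4; 8]]; [:: [:: 7; 10]];
      [:: [:: 1; 3; 6]]]
  isT isT).
Qed.

Lemma realizable_3_3_2_2 : realizable T [:: 3; 3; 2; 2].
Proof.
exact: realizable_forget (@marked_realizable_witness T _
  [:: 0; 4; 3; 7; 8; 2; 5; 1; 6; 9] (iota 0 10)
  [:: [:: [:: 0; 2; 1]]; [:: [:: 3; 8; 6]]; [:: [:: 4; 9]]; [:: [:: 5; 7]]]
  isT isT).
Qed.

Lemma realizable_3_3 : realizable T [:: 3; 3].
Proof.
exact: realizable_forget (@marked_realizable_witness T _
  [:: 0; 1; 3; 2; 5; 4] (iota 0 6)
  [:: [:: [:: 0; 3; 2]]; [:: [:: 1; 5; 4]]]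
  isT isT).
Qed.

Lemma realizable_3_3_3 : realizable T [:: 3; 3; 3].
Proof.
exact: realizable_forget (@marked_realizable_witness T _
  [:: 0; 2; 3; 6; 4; 8; 5; 1; 7] (iota 0 9)
  [:: [:: [:: 0; 3; 1]]; [:: [:: 2; 8; 5]]; [:: [:: 4; 7; 6]]]
  isT isT).
Qed.

(** The infinite families start from a marked solution. A mark needs a cycle of
    length at least 4, which is why the cycle that grows starts with length 4
    or 5. *)
Lemma realizable_5k k : realizable T [:: 5 + k.*2].
Proof.
exact: (@realizable_grow 2 1 2 [::] k isT isT
  (@marked_realizable_witness T _
     [:: 0; 3; 4; 1; 2] (iota 0 5)
     [:: [:: [:: 4; 1]; [:: 3]; [:: 2; 0]]]
     isT isT)).
Qed.

Lemma realizable_4k_2 k : realizable T [:: 4 + k.*2; 2].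
Proof.
exact: (@realizable_grow 2 1 1 [:: [:: 2]] k isT isT
  (@marked_realizable_witness T _
     [:: 0; 2; 1; 5; 3; 4] (iota 0 6)
     [:: [:: [:: 4; 0]; [:: 3]; [:: 1]]; [:: [:: 2; 5]]]
     isT isT)).
Qed.

Lemma realizable_4k_4 k : realizable T [:: 4 + k.*2; 4].
Proof.
exact: (@realizable_grow 2 1 1 [:: [:: 4]] k isT isT
  (@marked_realizable_witness T _
     [:: 0; 2; 3; 1; 5; 6; 4; 7] (iota 0 8)
     [:: [:: [:: 3; 5]; [:: 2]; [:: 7]]; [:: [:: 0; 6; 4; 1]]]
     isT isT)).
Qed.

Lemma realizable_5k_3 k : realizable T [:: 5 + k.*2; 3].
Proof.
exact: (@realizable_grow 2 2 1 [:: [:: 3]] k isT isT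
  (@marked_realizable_witness T _
     [:: 0; 5; 6; 3; 7; 2; 4; 1] (iota 0 8)
     [:: [:: [:: 1; 6]; [:: 4; 0]; [:: 3]]; [:: [:: 2; 5; 7]]]
     isT isT)).
Qed.

Lemma realizable_5k_2_2 k : realizable T [:: 5 + k.*2; 2; 2].
Proof.
exact: (@realizable_grow 2 2 1 [:: [:: 2]; [:: 2]] k isT isT
  (@marked_realizable_witness T _
     [:: 0; 4; 3; 1; 8; 2; 6; 7; 5] (iota 0 9)
     [:: [:: [:: 8; 4]; [:: 1; 7]; [:: 3]]; [:: [:: 0; 6]]; [:: [:: 2; 5]]]
     isT isT)).
Qed.

Lemma realizable_4k_2_3 k : realizable T [:: 4 + k.*2; 2; 3].
Proof.
exact: (@realizable_grow 2 1 1 [:: [:: 2]; [:: 3]] k isT isT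
  (@marked_realizable_witness T _
     [:: 0; 1; 6; 8; 2; 5; 3; 7; 4] (iota 0 9)
     [:: [:: [:: 1; 7]; [:: 0]; [:: 2]]; [:: [:: 4; 8]]; [:: [:: 3; 6; 5]]]
     isT isT)).
Qed.

Lemma realizable_4k_4_3 k : realizable T [:: 4 + k.*2; 4; 3].
Proof.
exact: (@realizable_grow 2 1 1 [:: [:: 4]; [:: 3]] k isT isT
  (@marked_realizable_witness T _
     [:: 0; 2; 8; 3; 7; 6; 4; 1; 9; 10; 5] (iota 0 11)
     [:: [:: [:: 10; 4]; [:: 9]; [:: 6]]; [:: [:: 1; 3; 5; 8]]; [:: [:: 0; 2; 7]]]
     isT isT)).
Qed.

Lemma realizable_4k_2_2_2 k : realizable T [:: 4 + k.*2; 2; 2; 2].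
Proof.
exact: (@realizable_grow 2 1 1 [:: [:: 2]; [:: 2]; [:: 2]] k isT isT
  (@marked_realizable_witness T _
     [:: 0; 1; 7; 8; 3; 6; 9; 5; 4; 2] (iota 0 10)
     [:: [:: [:: 8; 5]; [:: 7]; [:: 4]]; [:: [:: 0; 3]]; [:: [:: 1; 6]];
         [:: [:: 2; 9]]]
     isT isT)).
Qed.

(** Marks on two different cycles can be used independently. *)
Lemma realizable_grow2 s1 s2 s3 t1 t2 t3 d j k :
    1 < s1 -> 0 < s2 -> 1 < t1 -> 0 < t2 ->
    marked_realizable T ([:: s1; s2; s3] :: [:: t1; t2; t3] :: d) ->
  realizable T [:: s1 + s2 + s3 + j.*2, t1 + t2 + t3 + k.*2 & map sumn d].
Proof.
move=> s1_gt1 s2_gt0 t1_gt1 t2_gt0 /(marked_realizable_grow j s1_gt1 s2_gt0).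
case=> r1 [r2 [r1_gt1 r2_gt0 def_r Rr]].
apply: (@realizable_perm _ [:: t1 + t2 + t3 + k.*2, s1 + s2 + s3 + j.*2 & map sumn d]).
  exact: (permEl (perm_catCA [:: _] [:: _] _)).
have -> : s1 + s2 + s3 + j.*2 = sumn [:: r1; r2; s3].
  by rewrite /= addn0 addnA def_r addnAC.
apply: (@realizable_grow t1 t2 t3 ([:: r1; r2; s3] :: d)) => //.
move: Rr; apply: marked_realizable_perm; exact: (permEl (perm_catCA [:: _] [:: _] _)).
Qed.

(** The explicit solution with two marks has type (6, 4), hence the separate
    treatment of j = 0. *)
Lemma realizable_4j_4k j k : realizable T [:: 4 + j.*2; 4 + k.*2].
Proof.
case: j => [|j].
  have := @realizable_4k_4 k; apply: realizable_perm.
  exact: (permEl (perm_catCA [:: _] [:: _] _)).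
rewrite doubleS.
exact: (@realizable_grow2 2 3 1 2 1 1 [::] j k isT isT isT isT
  (@marked_realizable_witness T _
     [:: 0; 5; 6; 8; 3; 7; 1; 4; 9; 2] (iota 0 10)
     [:: [:: [:: 9; 1]; [:: 4; 0; 8]; [:: 7]]; [:: [:: 6; 2]; [:: 5]; [:: 3]]]
     isT isT)).
Qed.

Lemma realizable_4j_4k_3 j k : realizable T [:: 4 + j.*2; 4 + k.*2; 3].
Proof.
case: j => [|j].
  have := @realizable_4k_4_3 k; apply: realizable_perm.
  exact: (permEl (perm_catCA [:: _] [:: _] _)).
rewrite doubleS.
exact: (@realizable_grow2 3 1 2 2 1 1 [:: [:: 3]] j k isT isT isT isT
  (@marked_realizable_witness T _
     [:: 0; 2; 1; 4; 11; 8; 9; 7; 10; 6; 5; 3; 12] (iota 0 13)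
     [:: [:: [:: 0; 5; 1]; [:: 12]; [:: 2; 4]];
         [:: [:: 9; 6]; [:: 8]; [:: 10]]; [:: [:: 3; 7; 11]]]
     isT isT)).
Qed.


(** * All even cycle types *)

(** No commutator of two full cycles has one of these types: two cycles of
    length 3 on 3 points commute, and (2, 2) on 4 or 5 points is excluded by a
    finite enumeration. *)
Definition exceptional l :=
  [|| perm_eq l [:: 3], perm_eq l [:: 2; 2] | perm_eq l [:: 2; 2; 1]].

Definition nearly_realizable l := [\/ l = [::], exceptional l | realizable T l].

(** The rest r may itself be exceptional, so a block is only useful together
    with its unions with (3) and with (2, 2). The union with (2, 2, 1) comes for
    free, since a fixed point can always be glued. *)
Lemma realizable_block b r :
    realizable T b -> realizable T (b ++ [:: 3]) -> realizable T (b ++ [:: 2; 2]) ->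
  nearly_realizable r -> realizable T (b ++ r).
Proof.
move=> Rb Rb3 Rb22 [-> | /or3P[] r_exc | Rr].
- by rewrite cats0.
- by apply: realizable_perm Rb3; rewrite perm_cat2l perm_sym.
- by apply: realizable_perm Rb22; rewrite perm_cat2l perm_sym.
- apply: realizable_perm (realizable_cat Rb22 realizable_1).
  by rewrite -catA perm_cat2l perm_sym.
exact: realizable_cat.
Qed.

(** A fixed point does not fit the previous scheme, because (1, 2, 2) is itself
    exceptional. *)
Lemma nearly_realizable_one r : nearly_realizable r -> nearly_realizable (1 :: r).
Proof.
case=> [-> | /or3P[] r_exc | Rr].
- exact: Or33 realizable_1.
- by apply: Or33; apply: realizable_perm realizable_1_3; rewrite perm_cons perm_sym.
- apply: Or32; apply/or3P; apply: Or33.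
  by rewrite perm_sym (perm_catC [:: 2; 2] [:: 1]) perm_cons perm_sym.
- apply: Or33; apply: realizable_perm realizable_1_1_2_2.
  by rewrite perm_cons perm_sym (permPl r_exc) (perm_catC [:: 2; 2] [:: 1]).
by apply: Or33; apply: (realizable_cat realizable_1 Rr).
Qed.

(** For b > 2 the type (a, b, 2, 2) is the union of (a, 2) and (b, 2). For b = 2
    this would use the exceptional (2, 2), so (a, 2, 2, 2) comes from its own
    family. *)
Lemma realizable_even_pair a b :
    ~~ odd a -> ~~ odd b -> 4 <= a -> 2 <= b ->
  [/\ realizable T [:: a; b], realizable T [:: a; b; 3]
    & realizable T [:: a; b; 2; 2]].
Proof.
move=> a_even b_even a_ge4; have [j ->] : exists j, a = 4 + j.*2.
  exists (a - 4)./2; rewrite even_halfK ?subnKC //.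
  by rewrite oddB // (negPf a_even).
rewrite leq_eqVlt => /orP[/eqP<- | b_gt2].
  split; [exact: realizable_4k_2 | exact: realizable_4k_2_3 | exact: realizable_4k_2_2_2].
have [k ->] : exists k, b = 4 + k.*2.
  have b_ge4 : 4 <= b by case: b b_even b_gt2 => [|[|[|[|b]]]].
  exists (b - 4)./2; rewrite even_halfK ?subnKC //.
  by rewrite oddB // (negPf b_even).
split; [exact: realizable_4j_4k | exact: realizable_4j_4k_3 |].
have := realizable_cat (@realizable_4k_2 j) (@realizable_4k_2 k).
apply: realizable_perm.
by rewrite /= perm_cons (perm_catCA [:: _] [:: _] [:: _]).
Qed.

Lemma nearly_realizable_perm l l' :
  perm_eq l l' -> nearly_realizable l -> nearly_realizable l'.
Proof.
move=> perm_l [def_l | exc_l | Rl].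
- by apply: Or31; move: perm_l; rewrite def_l => /perm_size/esym/size0nil.
- by apply: Or32; move: exc_l; rewrite /exceptional !(permPl perm_l).
by apply: Or33; apply: realizable_perm Rl.
Qed.

Lemma perm_twos_threes l : all (fun k => (k == 2) || (k == 3)) l ->
  perm_eq l (nseq (count_mem 3 l) 3 ++ nseq (count_mem 2 l) 2).
Proof.
elim: l => //= k l IH /andP[/orP[]/eqP-> /IH perm_l] /=.
  rewrite ?add0n ?add1n /=; move: perm_l; rewrite -(perm_cons 2) => /permPl->.
  by rewrite (perm_catCA [:: 2]).
by rewrite ?add1n ?add0n /= perm_cons.
Qed.

(** Strong induction on the number of cycles, taking away a block (1), (k) with
    k odd and at least 5, or (a, b) with a and b even and a at least 4; in the
    last case b exists because the number of even cycles is even. Otherwise all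
    cycles have length 2 or 3; take away (3, 3) or (2, 2, 2, 2) while possible.
    What remains is empty, (3), (2, 2) or (3, 2, 2). *)
Lemma nearly_realizable_even l :
  all (leq 1) l -> ~~ odd (count (fun k => ~~ odd k) l) -> nearly_realizable l.
Proof.
have [n] := ubnP (size l); elim: n l => // n IH l; rewrite ltnS => size_l pos_l even_l.
have peel b r : perm_eq l (b ++ r) -> 0 < size b ->
    ~~ odd (count (fun k => ~~ odd k) b) -> nearly_realizable r.
  move=> perm_l b_gt0 even_b; apply: IH.
  - by move: size_l; rewrite (perm_size perm_l) size_cat; case: (size b) b_gt0 => // s _;
       rewrite addSn; apply: leq_ltn_trans; rewrite leq_addl.
  - by move: pos_l; rewrite (perm_all _ perm_l) all_cat => /andP[].
  by move: even_l; rewrite (seq.permP perm_l) count_cat oddD (negPf even_b).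
have block b r : perm_eq l (b ++ r) -> 0 < size b ->
    ~~ odd (count (fun k => ~~ odd k) b) ->
    [/\ realizable T b, realizable T (b ++ [:: 3]) & realizable T (b ++ [:: 2; 2])] ->
  nearly_realizable l.
  move=> perm_l b_gt0 even_b [Rb Rb3 Rb22].
  apply: (nearly_realizable_perm (l := b ++ r)); first by rewrite perm_sym.
  by apply: Or33; apply: realizable_block => //; apply: (peel b).
have [l1 | no1] := boolP (1 \in l).
  have perm_l := perm_to_rem l1.
  apply: (nearly_realizable_perm (l := 1 :: rem 1 l)); first by rewrite perm_sym.
  by apply: nearly_realizable_one; apply: (peel [:: 1]).
have [/hasP[a la /andP[a_odd a_ge5]] | no_odd] := boolP (has (fun k => odd k && (4 < k)) l).
  apply: (block [:: a] (rem a l)) => //; first exact: perm_to_rem.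
    by rewrite /= a_odd.
  have -> : a = 5 + (a - 5)./2.*2.
    by rewrite even_halfK ?subnKC // oddB // a_odd.
  by split; [exact: realizable_5k | exact: realizable_5k_3 | exact: realizable_5k_2_2].
have [/hasP[a la /andP[a_even a_ge4]] | no_even] := boolP (has (fun k => ~~ odd k && (3 < k)) l).
  have perm_l := perm_to_rem la.
  have /hasP[b b_rem b_even] : has (fun k => ~~ odd k) (rem a l).
    by move: even_l; rewrite has_count (seq.permP perm_l) /= a_even; case: count.
  have b_ge2 : 2 <= b.
    have: 1 <= b by apply: (allP pos_l); apply: mem_rem b_rem.
    by case: b b_even {b_rem} => [|[|b]].
  apply: (block [:: a; b] (rem b (rem a l))) => //.
  - by rewrite (permPl perm_l) perm_cons perm_to_rem.
  - by rewrite /= a_even b_even.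
  exact: realizable_even_pair.
have /perm_twos_threes perm_l : all (fun k => (k == 2) || (k == 3)) l.
  apply/allP => k lk; have k_gt0 := allP pos_l k lk.
  have /negP := hasPn no_odd k lk; have /negP := hasPn no_even k lk.
  have : k != 1 by apply: contraNneq no1 => <-.
  case: k k_gt0 {lk} => [|[|[|[|k]]]] //= _ _.
  by case: k => [|k] //=; case: (odd k).
move: (count_mem 3 l) (count_mem 2 l) perm_l => i j perm_l.
have j_even : ~~ odd j.
  move: even_l; rewrite (seq.permP perm_l) count_cat !count_nseq /= mul0n mul1n.
  by [].
case: i perm_l => [|[|i]] perm_l; last first.
- apply: (block [:: 3; 3] (nseq i 3 ++ nseq j 2)) => //.
  by split; [exact: realizable_3_3 | exact: realizable_3_3_3 | exact: realizable_3_3_2_2].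
- case: j j_even perm_l => [|[|[|[|j]]]] //= _ perm_l.
  + by apply: Or32; rewrite /exceptional perm_l.
  + by apply: Or33; apply: realizable_perm realizable_3_2_2; rewrite perm_sym.
  apply: (block [:: 2; 2; 2; 2] (nseq j 2 ++ [:: 3])) => //.
    by rewrite (permPl perm_l) -(perm_rot 1) /= rot1_cons -cats1.
  by split; [exact: realizable_2_2_2_2 | exact: realizable_2_2_2_2_3
    | exact: realizable_2_2_2_2_2_2].
case: j j_even perm_l => [|[|[|[|j]]]] //= _ perm_l.
- by apply: Or31; apply: size0nil; rewrite (perm_size perm_l).
- by apply: Or32; rewrite /exceptional perm_l orbT.
apply: (block [:: 2; 2; 2; 2] (nseq j 2)) => //.
by split; [exact: realizable_2_2_2_2 | exact: realizable_2_2_2_2_3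
  | exact: realizable_2_2_2_2_2_2].
Qed.

Lemma realizable_even l :
    all (leq 1) l -> ~~ odd (count (fun k => ~~ odd k) l) -> 6 <= sumn l ->
  realizable T l.
Proof.
move=> pos_l even_l l_ge6; have [def_l | /or3P[] l_exc |//] := nearly_realizable_even pos_l even_l.
- by rewrite def_l in l_ge6.
- by rewrite (perm_sumn l_exc) in l_ge6.
- by rewrite (perm_sumn l_exc) in l_ge6.
- by rewrite (perm_sumn l_exc) in l_ge6.
Qed.

End Types.

(** * From cycle types to permutations *)

Section CycleDecomposition.

Variable T : finType.
Implicit Types s : {perm T}.

Lemma fcycle_porbit s x : fcycle s (traject s x #|porbit s x|).
Proof.
have := iter_porbit s x; case: #|_| => //= k loop.
by rewrite -[X in rcons _ X]loop -iterS iterSr -trajectSr fpath_traject.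
Qed.

(** A cyclic word for the cycle with underlying set B; the starting point is
    arbitrary. *)
Definition cycle_at s (B : {set T}) : seq T :=
  if [pick x in B] is Some x then traject s x #|porbit s x| else [::].

Lemma cycle_atP s B : B \in porbits s ->
  [/\ cycle_at s B =i B, uniq (cycle_at s B) & fcycle s (cycle_at s B)].
Proof.
case/imsetP=> y _ ->; rewrite /cycle_at.
case: pickP => [x xy|/(_ y)]; last by rewrite porbit_id.
split; [|exact: uniq_traject_porbit|exact: fcycle_porbit].
move=> z; rewrite -porbit_traject; congr (z \in (_ : {set T})); apply/eqP.
by rewrite eq_porbit_mem.
Qed.

Lemma perm_cycles s : exists cs : seq (seq T),
  [/\ perm_eq (flatten cs) (enum T), size cs = #|porbits s|,
      all (leq 1) (shape cs)
    & {in cs, forall c, {in c, next c =1 s}}].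
Proof.
pose cs := [seq cycle_at s B | B <- enum (porbits s)].
have cs_at c : c \in cs -> exists2 B, B \in porbits s & c = cycle_at s B.
  by case/mapP=> B; rewrite mem_enum => B_s ->; exists B.
exists cs; split; last 2 first.
- apply/allP => _ /mapP[c /cs_at[B B_s ->] ->].
  have [mem_c _ _] := cycle_atP B_s; have [x _ def_B] := imsetP B_s.
  have : x \in cycle_at s B by rewrite mem_c def_B porbit_id.
  by case: cycle_at.
- by move=> c /cs_at[B /cycle_atP[_ _ cyc] ->] x xc; apply: nextE.
- apply: uniq_perm; rewrite ?enum_uniq //.
    rewrite /cs; have: {subset enum (porbits s) <= porbits s}.
      by move=> B; rewrite mem_enum.
    elim: (enum _) (enum_uniq (porbits s)) => //= B Bs IH /andP[BBs UBs] sub.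
    have B_s : B \in porbits s by rewrite sub ?mem_head.
    have [mem_B U_B _] := cycle_atP B_s.
    rewrite cat_uniq U_B IH //=; last by move=> P P_Bs; rewrite sub // inE P_Bs orbT.
    rewrite andbT; apply/hasPn => x /flattenP[_ /mapP[P P_Bs ->]].
    have P_s : P \in porbits s by rewrite sub // inE P_Bs orbT.
    have [mem_P _ _] := cycle_atP P_s; rewrite mem_P mem_B.
    move=> xP; apply: contra BBs => xB.
    suff -> : B = P by [].
    case/imsetP: B_s xB => y _ -> xy; case/imsetP: P_s xP => z _ -> xz.
    by move: xy xz; rewrite -!eq_porbit_mem => /eqP<- /eqP<-.
  move=> x; rewrite mem_enum; have x_s : porbit s x \in porbits s by apply: imset_f.
  apply/flattenP; exists (cycle_at s (porbit s x)).
    by apply: map_f; rewrite mem_enum.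
  by have [-> _ _] := cycle_atP x_s; exact: porbit_id.
by rewrite size_map -cardE.
Qed.

End CycleDecomposition.

(** Modulo 2, both sides are the sum of the k - 1; for the cycle lengths of a permutation
    this is its sign. *)
Lemma odd_sumn (l : seq nat) :
  odd (sumn l) (+) odd (size l) = odd (count (fun k => ~~ odd k) l).
Proof.
elim: l => //= k l IH; rewrite !oddD -IH.
by case: (odd k); case: (odd (sumn l)); case: (odd (size l)).
Qed.

Lemma perm_next_full_cycle n (st : seq 'I_n) (Ust : uniq st) :
  size st = n -> perm (next_inj Ust) \in full_cycles n.
Proof.
move/eqP=> size_st; rewrite inE; apply/existsP; exists (Tuple size_st) => /=.
rewrite Ust (eq_cycle (e' := frel (next st))); first exact: cycle_next.
by move=> x y /=; rewrite permE.
Qed.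

Theorem theorem1p1 (n : nat) (hn : 6 <= n) :
  (forall tau pi : 'S_n,
      tau \in full_cycles n -> pi \in full_cycles n ->
      rlcomm tau pi \in ('Alt_('I_n))%g) /\
  (forall sigma : 'S_n, sigma \in ('Alt_('I_n))%g ->
      exists tau pi : 'S_n,
        [/\ tau \in full_cycles n, pi \in full_cycles n
          & rlcomm tau pi = sigma]).
Proof.
split=> [tau pi _ _ | sigma].
  rewrite Alt_even /rlcomm /rlmul !odd_permM !odd_permV.
  by case: (odd_perm tau); case: (odd_perm pi).
rewrite Alt_even => sigma_even.
have [cs [cs_pts size_cs pos_cs cs_sigma]] := perm_cycles sigma.
have size_pts : size (flatten cs) = n.
  by rewrite (perm_size cs_pts) -cardE card_ord.
have [|||st [sp]] := @realizable_even 'I_n (shape cs) pos_cs _ _ cs (erefl _).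
- rewrite -odd_sumn -size_flatten size_pts size_map size_cs.
  by move: sigma_even; rewrite /odd_perm card_ord.
- by rewrite -size_flatten size_pts.
- by rewrite (perm_uniq cs_pts) enum_uniq.
case/and4P=> st_pts sp_pts _ /allP sol.
have Ust : uniq st by rewrite (perm_uniq st_pts) (perm_uniq cs_pts) enum_uniq.
have Usp : uniq sp by rewrite (perm_uniq sp_pts) (perm_uniq cs_pts) enum_uniq.
exists (perm (next_inj Ust)), (perm (next_inj Usp)); split.
- by rewrite perm_next_full_cycle // (perm_size st_pts).
- by rewrite perm_next_full_cycle // (perm_size sp_pts).
apply/permP => y; rewrite /rlcomm /rlmul !permM.
have /flattenP[c c_cs yc] : y \in flatten cs by rewrite (perm_mem cs_pts) mem_enum.
have /allP/(_ y yc)/eqP := sol c c_cs; rewrite (cs_sigma c c_cs y yc) => eq_y.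
apply: (canLR (permK _)); apply: (canLR (permK _)).
by rewrite !permE eq_y.
Qed.
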